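(* Let $\Delta$ be a finite simplicial complex with vertex set $V$, let $f:V\to\mathbb{R}$ be injective and discrete smooth on $\Delta$, and let $\mathcal{V}$ be the discrete vector field given by the greedy matching $M$ on the weighted Hasse diagram of $\Delta$. For any $\mathcal{V}$-path $\sigma_0,\tau_0,\sigma_1,\tau_1,\dots,\sigma_{n-1},\tau_{n-1},\sigma_n$, if $\sigma_n$ is critical, then $f(\sigma_0)>f(\sigma_1)>\cdots>f(\sigma_n)$.
   Context: A finite simplicial complex $\Delta$ with (nonempty, finite) vertex set $V$ is a family of subsets of $V$ (simplices) containing every singleton $\{v\}$, $v\in V$, and closed under taking subsets (so $\emptyset\in\Delta$, of dimension $-1$). $\dim\sigma=|\sigma|-1$. We write $\sigma\prec\tau$ (or $\tau\succ\sigma$) if $\sigma\subset\tau$ and $\dim\sigma=\dim\tau-1$. A vertex $v$ is identified with $\{v\}$ in expressions such as $\sigma\setminus v$. The Hasse diagram $H$ of $\Delta$ has the simplices of $\Delta$ as nodes and an arc $\{\sigma,\tau\}$ for each pair $\sigma\prec\tau$. The weight of the arc $\{\sigma,\tau\}$ is $f(v)$, where $\tau\setminus\sigma=\{v\}$. Two arcs sharing a node always have different weights. Greedy matching $M$: start with $M=\emptyset$; while arcs remain, add all remaining arcs of minimum weight to $M$ and delete the end nodes of these arcs (with all their incident arcs). The associated discrete vector field $\mathcal{V}$ is the set of matched pairs; we write $\sigma\rightarrow\tau$ if $\sigma\prec\tau$ and $\{\sigma,\tau\}\in M$. A simplex is critical if it belongs to no pair of $\mathcal{V}$. A $\mathcal{V}$-path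 is a sequence of simplices $\sigma_0,\tau_0,\sigma_1,\dots,\tau_{n-1},\sigma_n$ such that $\sigma_i\rightarrow\tau_i$ and $\tau_i\succ\sigma_{i+1}\neq\sigma_i$ for $0\le i\le n-1$. For $\sigma\in\Delta$, $f(\sigma)=\{f(v):v\in\sigma\}$. For distinct simplices $\sigma,\sigma'$ of the same dimension (the only ones compared here), lexicographic order is: $f(\sigma)>f(\sigma')$ iff the maximum of the symmetric difference $f(\sigma)\,\triangle\,f(\sigma')$ belongs to $f(\sigma)$. For $\sigma\in\Delta$, $H(\sigma)=\{v\in V:\ v\in\sigma,\text{ or } v\notin\sigma\text{ and }\sigma\cup\{v\}\in\Delta\}$ and $h_f(\sigma)$ is the unique vertex of $H(\sigma)$ at which $f$ is minimal. A simplex $\sigma\in\Delta$ is discrete smooth if: whenever $h_f(\sigma)\in\sigma$, then for all $\tau\succ\sigma$ one has $h_f(\tau\setminus h_f(\sigma))=h_f(\sigma)$. The function $f$ is discrete smooth on $\Delta$ if every $\sigma\in\Delta$ is discrete smooth. *)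

(* Defs.v *)
(* MathComp, with classical sets and real numbers from MathComp-Analysis. *)
From mathcomp Require Import all_boot all_order all_algebra.
From mathcomp Require Import classical_sets reals.

Set Implicit Arguments.
Unset Strict Implicit.
Unset Printing Implicit Defensive.

Import Order.TTheory GRing.Theory Num.Theory.

Local Open Scope set_scope.
Local Open Scope ring_scope.

(* The vertex set is the whole type V. The empty set is a simplex,
   since V is nonempty. *)
Definition simplicial_complex (V : finType) (D : {set {set V}}) : Prop :=
  [/\ (0 < #|V|)%N,
      forall v : V, [set v] \in D
    & forall s t : {set V}, t \in D -> s \subset t -> s \in D].

(* As dim s = #|s| - 1, this is: s is a face of t of codimension one. *)
Definition facet (V : finType) (s t : {set V}) : bool :=
  (s \subset t) && (#|t| == #|s|.+1).

(* f v for t :\: s = [set v]; the value 0 is never used on actual arcs. *)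
Definition arc_weight (R : realType) (V : finType) (f : V -> R)
    (a : {set V} * {set V}) : R :=
  oapp f 0 (unset1 (a.2 :\: a.1)).

(* An arc of the Hasse diagram is the pair of its lower and upper end nodes;
   deleting nodes leaves the arcs induced on the set N of remaining nodes. *)
Definition arcs (V : finType) (N : {set {set V}}) : {set {set V} * {set V}} :=
  [set a : {set V} * {set V} | [&& a.1 \in N, a.2 \in N & facet a.1 a.2]].

Definition min_arcs (R : realType) (V : finType) (f : V -> R)
    (N : {set {set V}}) : {set {set V} * {set V}} :=
  [set a in arcs N | [forall b in arcs N, arc_weight f a <= arc_weight f b]].

Definition end_nodes (V : finType) (A : {set {set V} * {set V}}) :
    {set {set V}} :=
  [set s : {set V} | [exists a in A, (s == a.1) || (s == a.2)]].

(* The state is the pair of the remaining nodes and the current matching. *)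
Definition greedy_step (R : realType) (V : finType) (f : V -> R)
    (p : {set {set V}} * {set {set V} * {set V}}) :
    {set {set V}} * {set {set V} * {set V}} :=
  (p.1 :\: end_nodes (min_arcs f p.1), p.2 :|: min_arcs f p.1).

(* The step is the identity once no arc remains, and #|D| rounds are enough to
   reach that point: see greedy_state_no_arcs. *)
Definition greedy_state (R : realType) (V : finType) (f : V -> R)
    (D : {set {set V}}) : {set {set V}} * {set {set V} * {set V}} :=
  iter #|D| (greedy_step f) (D, finset.set0).

Definition greedy_matching (R : realType) (V : finType) (f : V -> R)
    (D : {set {set V}}) : {set {set V} * {set V}} :=
  (greedy_state f D).2.

Definition critical (R : realType) (V : finType) (f : V -> R)
    (D : {set {set V}}) (s : {set V}) : Prop :=
  s \in D /\
  forall a, a \in greedy_matching f D -> s != a.1 /\ s != a.2.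

(* The path s 0, t 0, s 1, ..., t n.-1, s n; other values of s and t are
   irrelevant. *)
Definition vpath (R : realType) (V : finType) (f : V -> R)
    (D : {set {set V}}) (n : nat) (s t : nat -> {set V}) : Prop :=
  [/\ forall i, (i <= n)%N -> s i \in D,
      forall i, (i < n)%N -> t i \in D
    & forall i, (i < n)%N ->
        [/\ facet (s i) (t i), (s i, t i) \in greedy_matching f D,
            facet (s i.+1) (t i) & s i.+1 != s i]].

Definition fimage (R : realType) (V : finType) (f : V -> R) (s : {set V}) :
    set R :=
  (f @` [set` s])%classic.

(* Lexicographic order on the value sets of two distinct simplices of equal
   dimension: the maximum m of the symmetric difference lies in A. *)
Definition lex_gt (R : realType) (A B : set R) : Prop :=
  exists m, [/\ (A `+` B)%classic m, ubound (A `+` B)%classic m & A m].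

Definition star_verts (V : finType) (D : {set {set V}}) (s : {set V}) :
    {set V} :=
  [set v | (v \in s) || ((v \notin s) && (v |: s \in D))].

(* For s in D this is Some of the unique minimizer of f on the nonempty set
   star_verts D s, when f is injective. *)
Definition hmin (R : realType) (V : finType) (f : V -> R)
    (D : {set {set V}}) (s : {set V}) : option V :=
  [pick v in star_verts D s | [forall w in star_verts D s, f v <= f w]].

Definition smooth_simplex (R : realType) (V : finType) (f : V -> R)
    (D : {set {set V}}) (s : {set V}) : Prop :=
  forall v, hmin f D s = Some v -> v \in s ->
  forall t, t \in D -> facet s t -> hmin f D (t :\ v) = Some v.

Definition discrete_smooth (R : realType) (V : finType) (f : V -> R)
    (D : {set {set V}}) : Prop :=
  forall s, s \in D -> smooth_simplex f D s.

Lemma min_arcs_neq0 (R : realType) (V : finType) (f : V -> R)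
    (N : {set {set V}}) :
  arcs N != finset.set0 -> min_arcs f N != finset.set0.
Proof.
case/finset.set0Pn=> a0 a0N; apply/finset.set0Pn.
case: (@Order.TotalTheory.arg_minP _ _ _ a0 (mem (arcs N)) (arc_weight f) a0N)
  => a aN a_min.
by exists a; rewrite inE; apply/andP; split=> //; apply/forall_inP.
Qed.

Lemma greedy_state_no_arcs (R : realType) (V : finType) (f : V -> R)
    (D : {set {set V}}) :
  arcs (greedy_state f D).1 = finset.set0.
Proof.
have arcsS (N N' : {set {set V}}) :
    N' \subset N -> arcs N = finset.set0 -> arcs N' = finset.set0.
  move=> /fintype.subsetP sN' N0; apply/finset.setP=> a; rewrite !inE.
  apply/negP=> /and3P[a1 a2 a12]; suff: a \in arcs N by rewrite N0 inE.
  by rewrite inE sN' // sN'.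
have step k : let p := iter k (greedy_step f) (D, finset.set0) in
    arcs p.1 = finset.set0 \/ (#|p.1| + k <= #|D|)%N.
  elim: k => [|k IHk] /=; first by right; rewrite addn0.
  set p := iter k _ _ in IHk *.
  have sub : p.1 :\: end_nodes (min_arcs f p.1) \subset p.1 by apply: subsetDl.
  case: (eqVneq (arcs p.1) finset.set0) => [p0|pn0].
    by left; apply: arcsS p0.
  right; case: IHk => [p0|le_pk]; first by rewrite p0 eqxx in pn0.
  rewrite addnS; apply: leq_trans le_pk; rewrite -addSn leq_add2r.
  apply: proper_card; apply/properP; split=> //.
  have /finset.set0Pn[a a_min] := min_arcs_neq0 f pn0.
  exists a.1; first by move: a_min; rewrite !inE => /andP[/and3P[]].
  rewrite inE negb_and negbK; apply/orP; left; rewrite inE.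
  by apply/exists_inP; exists a; rewrite // eqxx.
rewrite /greedy_state; case: (step #|D|) => //.
rewrite -{3}[#|D|]add0n leq_add2r leqn0 cards_eq0 => /eqP ->.
by apply/finset.setP=> a; rewrite !inE.
Qed.

(* Main.v *)
(* The least-weight arc at a node s has weight f (hmin s). If hmin s = v is
   not in s, then the arc (s, v |: s) has least weight at both of its end
   nodes, so the greedy algorithm selects it. Smoothness makes every matched
   arc (s, t) of this form: if m = hmin s were in s, then hmin (t :\ m) = m,
   so t would be matched with t :\ m, which is not s. Hence each step of a
   path trades some w in s i for v = hmin (s i), and f v < f w. *)
Require Import Defs.
From mathcomp Require Import all_boot all_order all_algebra.
From mathcomp Require Import classical_sets reals.

Set Implicit Arguments.
Unset Strict Implicit.
Unset Printing Implicit Defensive.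

Import Order.TTheory.

Local Open Scope set_scope.
Local Open Scope ring_scope.

Section GreedyMatching.
Variables (R : realType) (V : finType) (D : {set {set V}}) (f : V -> R).
Implicit Types (s t : {set V}) (a b : {set V} * {set V}) (v w : V).

Lemma facetP s t :
  reflect (exists2 v, v \notin s & t = v |: s) (facet s t).
Proof.
apply: (iffP andP) => [[st /eqP card_t]|[v vs ->]]; last first.
  by rewrite finset.subsetUr cardsU1 vs.
have /cards1P[v tsv] : #|t :\: s| == 1%N.
  by rewrite cardsDS // card_t subSnn.
exists v; first by have := finset.set11 v; rewrite -tsv inE => /andP[].
by rewrite -tsv -[LHS](finset.setID t s) (finset.setIidPr st) finset.setUC.
Qed.

Lemma arc_weightU1 s v : v \notin s -> arc_weight f (s, v |: s) = f v.
Proof.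
move=> vs; rewrite /arc_weight /=.
have -> : (v |: s) :\: s = [set v]%SET.
  apply/finset.setP=> w; rewrite !inE; case: eqVneq => [->|_] /=.
    by rewrite vs.
  by rewrite andNb.
by rewrite set1K.
Qed.

Definition ends a s : bool := (s == a.1) || (s == a.2).

Lemma ends_lower a : ends a a.1.
Proof. by rewrite /ends eqxx. Qed.

Lemma ends_upper a : ends a a.2.
Proof. by rewrite /ends eqxx orbT. Qed.

(** One formula serves both ends: [s :\ v] is [s] when [s] is the lower end, and [v |: s] is [s]
    when it is the upper one. So an arc at [s] is determined by the vertex [v]. *)
Lemma arc_at a s : facet a.1 a.2 -> ends a s ->
  exists2 v, a = (s :\ v, v |: s) & arc_weight f a = f v.
Proof.
case: a => x y /facetP[v vx /= ->] sa; exists v; last exact: arc_weightU1.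
case/orP: sa => /eqP /= ->.
  by rewrite (finset.setDidPl _) // disjoint_sym disjoints1.
by rewrite finset.setU1K // finset.setUA finset.setUid.
Qed.

Lemma end_nodesP (A : {set {set V} * {set V}}) s :
  reflect (exists2 a, a \in A & ends a s) (s \in end_nodes A).
Proof. by rewrite inE; apply: exists_inP. Qed.

Lemma min_arcsP (N : {set {set V}}) a :
  reflect (a \in arcs N /\
           {in arcs N, forall b, arc_weight f a <= arc_weight f b})
          (a \in min_arcs f N).
Proof.
rewrite [X in reflect _ X]finset.in_set.
apply: (iffP andP) => -[aN amin]; split=> //.
  exact/forall_inP.
exact/forall_inP.
Qed.

Lemma greedy_inv (P : {set {set V}} * {set {set V} * {set V}} -> Prop) :
  P (D, finset.set0) -> (forall p, P p -> P (greedy_step f p)) ->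
  P (greedy_state f D).
Proof. by move=> P0 PS; rewrite /greedy_state; elim: #|D| => //= k /PS. Qed.

Definition locally_minimal a :=
  forall b s, b \in arcs D -> ends a s -> ends b s ->
  arc_weight f a <= arc_weight f b.

(** Until [a] is selected, both its ends survive every round, and no arc remains in the final
    state. *)
Lemma locally_minimal_matched a :
  a \in arcs D -> locally_minimal a -> a \in greedy_matching f D.
Proof.
move=> aD amin.
pose P (p : {set {set V}} * {set {set V} * {set V}}) :=
  (p.1 \subset D) && ((a \in p.2) || (a \in arcs p.1)).
suff: P (greedy_state f D).
  by rewrite /P greedy_state_no_arcs [in X in _ || X]inE orbF => /andP[].
apply: (greedy_inv (P := P)) => [|[N M] /andP[/= ND]].
  by rewrite /P /= aD orbT subxx.
rewrite /P /= (fintype.subset_trans (finset.subsetDl _ _) ND) finset.in_setU /=.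
case/orP=> [->//|aN]; case: (boolP (a \in min_arcs f N)) => [_|aNmin].
  by rewrite orbT.
have arcsND b : b \in arcs N -> b \in arcs D.
  rewrite !inE => /and3P[b1 b2 ->]; rewrite andbT.
  by rewrite !(fintype.subsetP ND).
(* If a minimal arc [b] of this round met [a], local minimality would put [a] at or below [b], so
   [a] would be minimal in the round too. *)
have endN s : ends a s -> s \notin end_nodes (min_arcs f N).
  move=> sa; apply: contra aNmin => /end_nodesP[b /min_arcsP[bN bmin] sb].
  apply/min_arcsP; split=> // c cN; apply: le_trans (bmin _ cN).
  exact: amin (arcsND _ bN) sa sb.
rewrite orbF; apply/orP; right.
have [a1 a2 fa] : [/\ a.1 \in N, a.2 \in N & facet a.1 a.2].
  by apply/and3P; move: aN; rewrite inE.
rewrite finset.in_set !finset.in_setD a1 a2 fa !andbT.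
by apply/andP; split; apply: endN; rewrite ?ends_lower ?ends_upper.
Qed.

Hypothesis f_inj : injective f.

Lemma greedy_matching_disjoint a b s :
  a \in greedy_matching f D -> b \in greedy_matching f D ->
  ends a s -> ends b s -> a = b.
Proof.
(* The first clause, that ends of matched arcs are deleted, rules out a clash between arcs chosen in
   different rounds. *)
pose P (p : {set {set V}} * {set {set V} * {set V}}) :=
  (forall a s, a \in p.2 -> ends a s -> s \notin p.1) /\
  (forall a b s, a \in p.2 -> b \in p.2 -> ends a s -> ends b s -> a = b).
suff: P (greedy_state f D) by case=> _; apply.
apply: (greedy_inv (P := P)) => {a b s} [|[N M] [/= PN PM]].
  by split=> [a s|a b s]; rewrite inE.
have minN a s : a \in min_arcs f N -> ends a s -> s \in N.
  by case/min_arcsP; rewrite inE => /and3P[a1 a2 _] _ /orP[]/eqP->.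
split=> /= [a s|a b s]; rewrite !finset.in_setU.
  case/orP=> [aM|aN] sa; rewrite finset.in_setD negb_and.
    by rewrite (PN _ _ aM sa) orbT.
  by rewrite negbK; apply/orP; left; apply/end_nodesP; exists a.
case/orP=> [aM|aN] /orP[bM|bN] sa sb; first exact: PM sa sb.
- by have := PN _ _ aM sa; rewrite (minN _ _ bN sb).
- by have := PN _ _ bM sb; rewrite (minN _ _ aN sa).
(* Arcs of the same round have equal weights; at a common node, injectivity of [f] makes them
   equal. *)
have [aA amin] := min_arcsP _ _ aN; have [bA bmin] := min_arcsP _ _ bN.
have : arc_weight f a = arc_weight f b.
  by apply/eqP; rewrite eq_le amin // bmin.
move: aA bA; rewrite !inE => /and3P[_ _ fa] /and3P[_ _ fb].
have [v -> ->] := arc_at fa sa; have [w -> ->] := arc_at fb sb.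
by move/f_inj->.
Qed.

Lemma hminP s v :
  reflect (v \in star_verts D s /\
           {in star_verts D s, forall w, f v <= f w})
          (hmin f D s == Some v).
Proof.
rewrite /hmin; case: pickP => [u /andP[us /forall_inP umin]|none]; last first.
  constructor=> -[vs vmin]; have /negP[] := negbT (none v).
  by rewrite vs; apply/forall_inP.
apply: (iffP eqP) => [[<-]//|[vs vmin]]; congr Some.
by apply/f_inj/eqP; rewrite eq_le umin // vmin.
Qed.

Hypothesis D_complex : simplicial_complex D.

Lemma in_star_verts s v : s \in D -> (v \in star_verts D s) = (v |: s \in D).
Proof.
move=> sD; rewrite inE; case: (boolP (v \in s)) => //= vs.
by rewrite (finset.setUidPr _) ?sD // finset.sub1set.
Qed.

Lemma hmin_exists s : s \in D -> exists v, hmin f D s = Some v.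
Proof.
move=> sD; have [V_gt0 D1 _] := D_complex.
have [v0 v0s] : exists v, v \in star_verts D s.
  (* The empty simplex has no vertex of its own, but adding any vertex of [V] gives a singleton,
     which is a simplex. *)
  case: (finset.set_0Vmem s) => [s0|[v vs]]; last by exists v; rewrite inE vs.
  have /card_gt0P[v _] := V_gt0.
  by exists v; rewrite in_star_verts // s0 finset.setU0.
have [v vs vmin] := @arg_minP _ _ _ v0 (mem (star_verts D s)) f v0s.
by exists v; apply/eqP/hminP.
Qed.

Lemma hmin_matched s v : s \in D -> v \notin s -> hmin f D s = Some v ->
  (s, v |: s) \in greedy_matching f D.
Proof.
move=> sD vs /eqP/hminP[]; rewrite in_star_verts // => vsD vmin.
have [_ _ D_down] := D_complex.
apply: locally_minimal_matched => [|b r].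
  by rewrite inE sD vsD; apply/facetP; exists v.
rewrite inE => /and3P[_ b2 fb] rsv rb; rewrite arc_weightU1 //.
(* The upper end of [b] is [w |: r], which contains [w |: s] because [s] lies in [r]; hence [w]
   competes with [v] in the star of [s]. *)
have [w bE ->] := arc_at fb rb; apply: vmin; rewrite in_star_verts //.
apply: D_down b2 _; rewrite bE /= finset.setUS //.
by case/orP: rsv => /eqP-> //=; apply: finset.subsetUr.
Qed.

Lemma hmin_of_matched s v : discrete_smooth f D -> s \in D -> v |: s \in D ->
  v \notin s -> (s, v |: s) \in greedy_matching f D -> hmin f D s = Some v.
Proof.
move=> smooth sD tD vs sM; have [_ _ D_down] := D_complex.
have [m ms] := hmin_exists sD; case: (boolP (m \in s)) => [m_in|m_notin].
  have st : facet s (v |: s) by apply/facetP; exists v.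
  have mt := smooth _ sD _ ms m_in _ tD st.
  have mtM : ((v |: s) :\ m, v |: s) \in greedy_matching f D.
    rewrite -{2}(@finset.setD1K _ m (v |: s)) ?inE ?m_in ?orbT //.
    apply: hmin_matched mt; rewrite ?inE ?eqxx //.
    by apply: D_down tD _; apply: finset.subsetDl.
  (* Both matched arcs have upper end [v |: s], so their lower ends agree and [m] is missing from
     [s], a contradiction. *)
  have [sE] := greedy_matching_disjoint sM mtM
    (ends_upper (s, v |: s)) (ends_upper (_, v |: s)).
  by move: m_in; rewrite sE !inE eqxx.
(* Here the two arcs share the lower end [s]; comparing their upper ends gives [m = v]. *)
have [tE] := greedy_matching_disjoint sM (hmin_matched sD m_notin ms)
  (ends_lower (s, v |: s)) (ends_lower (s, _)).
have : v \in m |: s by rewrite -tE finset.setU11.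
by rewrite !inE (negPf vs) orbF => /eqP->.
Qed.

(** By injectivity the value sets differ exactly in [f v] and [f w], and the larger of these belongs
    to [s]. *)
Lemma lex_gt_exchange s v w : v \notin s -> w \in s -> f v < f w ->
  lex_gt (fimage f s) (fimage f ((v |: s) :\ w)).
Proof.
move=> vs ws vw; exists (f w).
have fsw : fimage f s (f w) by exists w.
split=> //.
  by left; split=> // -[y /= + /f_inj yw]; rewrite yw !inE eqxx.
move=> x [[[y /= ys <-] ny]|[[y /= ys <-] ny]].
  case: (eqVneq y w) => [->//|yw]; case: ny; exists y => //=.
  by rewrite !inE yw ys orbT.
move: ys; rewrite !inE => /andP[_ /orP[/eqP->|ys]]; first exact: ltW.
by case: ny; exists y.
Qed.

End GreedyMatching.

Theorem theorem23 (R : realType) (V : finType) (D : {set {set V}})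
    (f : V -> R) (n : nat) (s t : nat -> {set V}) :
  simplicial_complex D ->
  injective f ->
  discrete_smooth f D ->
  vpath f D n s t ->
  critical f D (s n) ->
  forall i : nat, (i < n)%N -> lex_gt (fimage f (s i)) (fimage f (s i.+1)).
Proof.
move=> D_complex f_inj smooth [sD tD path] _ i lt_in.
have [/facetP[v vs tE] sM /facetP[w ws' tE'] ss'] := path i lt_in.
have siD := sD i (ltnW lt_in); have tiD := tD i lt_in.
rewrite tE in tiD sM.
have /eqP/hminP[//|_ vmin] :=
  hmin_of_matched f_inj D_complex smooth siD tiD vs sM.
(* The upper simplex [t i] is both [v |: s i] and [w |: s i.+1]; since the path does not turn back,
   [w] differs from [v] and so lies in [s i]. *)
have sE : s i.+1 = (v |: s i) :\ w by rewrite -tE tE' finset.setU1K.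
have wv : w != v.
  by apply: contra ss' => /eqP wv; rewrite sE wv finset.setU1K.
have ws : w \in s i.
  have : w \in v |: s i by rewrite -tE tE' finset.setU11.
  by rewrite !inE (negPf wv).
rewrite sE; apply: lex_gt_exchange => //.
rewrite lt_neqAle (inj_eq f_inj) eq_sym wv vmin //.
by rewrite inE ws.
Qed.
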